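(* Let $L$ be the three-dimensional Lie algebra over the finite field $\mathbb{F}_q$ with basis $x,y,z$ and brackets $[x,y]=y$, $[x,z]=[y,z]=0$, so that $L'=\langle y\rangle$ and $Z(L)=\langle z\rangle$. Let $\mathcal{L}$ be the set of one-dimensional subalgebras (lines) and $\mathcal{P}$ the set of two-dimensional subalgebras (planes) of $L$. The elements of $\mathcal{P}$ are of the following two types: (i) the $q+1$ two-dimensional subspaces containing $L'=\langle y\rangle$; (ii) the $q$ abelian planes $P_\alpha:=\langle x+\alpha y,\,z\rangle$ with $\alpha\in\mathbb{F}_q$, which do not contain $y$. In particular, $|\mathcal{P}|=2q+1$. The comaximal graph $\Gamma(L)$ has vertex set $\mathcal{L}\sqcup\mathcal{P}$, and adjacency is described as follows: (1) If $A,B\in\mathcal{P}$ with $A\neq B$, then $A\sim B$. Hence the induced subgraph on $\mathcal{P}$ is the complete graph $K_{2q+1}$. (2) If $A\in\mathcal{L}$ and $P\in\mathcal{P}$, then $A\sim P$ if and only if $A\not\subseteq P$. (3) Let $V:=\langle y,z\rangle$. Then adjacency between lines is as follows: (a) The lines $\langle y\rangle$ and $\langle z\rangle$ are not adjacent to any line. (b) If $A\leq V$ is a line with $\langle y\rangle\neq A\neq\langle z\rangle$, then $A$ is adjacent to every line not contained in $V$, and to no line contained in $V$. (c) Every line not contained in $V$ can be written uniquely as $X_{a,b}=\langle x+ay+bz\rangle$ with $a,b\in\mathbb{F}_q$. For two such lines $X_{a,b}$ and $X_{c,d}$ one has $X_{a,b}\sim X_{c,d}$ if and only if $a\neq c$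 and $b\neq d$. (4) The degrees of the vertices are as follows: (a) $\deg(P)=q^2+2q$ for every $P\in\mathcal{P}$. (b) $\deg(\langle y\rangle)=\deg(\langle z\rangle)=q$. (c) If $A\leq V$ is a line with $\langle y\rangle\neq A\neq\langle z\rangle$, then $\deg(A)=q^2+2q$. (d) If $A$ is a line with $A\not\leq V$, then $\deg(A)=q^2+q-1$.
   Context: The comaximal graph $\Gamma(L)$ of a finite-dimensional Lie algebra $L$ is the simple undirected graph whose vertices are the nonzero proper Lie subalgebras of $L$, two distinct vertices $A,B$ being adjacent (written $A\sim B$) if and only if the Lie subalgebra $\langle A,B\rangle$ generated by $A\cup B$ equals $L$. For elements $u,v,\dots$ of $L$, $\langle u,v,\dots\rangle$ in the definitions of the lines and planes above denotes the linear span. $L'=[L,L]$ is the derived algebra. *)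

(* Defs.v *)
From HB Require Import structures.
From mathcomp Require Import all_boot all_order all_algebra all_field.

Set Implicit Arguments.
Unset Strict Implicit.
Unset Printing Implicit Defensive.

Import GRing.Theory.
Local Open Scope ring_scope.

(* Finite-dimensional Lie algebras over a field; the bracket [u, v] is written *)
(* lie u v.                                                                   *)
HB.mixin Record Vector_isLie (K : fieldType) (L : Type) of Vector K L := {
  lie : L -> L -> L;
  lie_linearl : forall v, linear (lie ^~ v);
  lie_linearr : forall u, linear (lie u);
  lieuu : forall u, lie u u = 0;
  lie_jacobi : forall u v w,
    lie u (lie v w) + lie v (lie w u) + lie w (lie u v) = 0
}.

#[short(type="lieAlgType")]
HB.structure Definition LieAlgebra (K : fieldType) :=
  { L of Vector_isLie K L & Vector K L }.

Lemma lie_is_bilinear (K : fieldType) (L : lieAlgType K) :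
  bilinear_for (GRing.Scale.Law.clone _ _ *:%R _)
    (GRing.Scale.Law.clone _ _ *:%R _) (@lie K L).
Proof. by split; [apply: lie_linearl | apply: lie_linearr]. Qed.

HB.instance Definition _ (K : fieldType) (L : lieAlgType K) :=
  bilinear_isBilinear.Build K L L L _ _ (@lie K L) (@lie_is_bilinear K L).

(* Over a finite field there are finitely many subspaces. This makes          *)
(* {set {vspace L}}, cardinals and \bigcap over subspaces available.          *)
Definition vspace_code (F : finFieldType) (vT : vectType F)
  (U : {vspace vT}) : 'M[F]_(dim vT) := VectorInternalTheory.vs2mx U.

Lemma vspace_codeK (F : finFieldType) (vT : vectType F) :
  pcancel (@vspace_code F vT) (fun M => Some (VectorInternalTheory.mx2vs M)).
Proof. by move=> U; congr Some; apply: VectorInternalTheory.vs2mxK. Qed.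

HB.instance Definition _ (F : finFieldType) (vT : vectType F) :=
  PCanIsCountable (@vspace_codeK F vT).
HB.instance Definition _ (F : finFieldType) (vT : vectType F) :
    isFinite {vspace vT} :=
  PCanIsFinite (@vspace_codeK F vT).

Section LieSubalgebras.
Variables (F : fieldType) (L : lieAlgType F).
Implicit Types (u v : L) (U V W : {vspace L}).

(* The span of all brackets lie u v, u in U, v in V: see lievP below.         *)
Definition liev U V : {vspace L} :=
  <<[seq lie u v | u <- vbasis U, v <- vbasis V]>>%VS.

Definition lie_subalg U : bool := (liev U U <= U)%VS.

Definition lie_abelian U : bool := liev U U == 0%VS.

Definition lie_derived : {vspace L} := liev fullv fullv.

Definition lie_central u : Prop := forall v, lie u v = 0.

Lemma memv_lie U V u v : u \in U -> v \in V -> lie u v \in liev U V.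
Proof.
move=> Uu Vv; rewrite (coord_vbasis Uu) (coord_vbasis Vv).
rewrite linear_sumlz; apply: memv_suml => i _.
rewrite linear_sumr; apply: memv_suml => j _.
rewrite linearZl_LR linearZr_LR; apply/memvZ/memvZ/memv_span/allpairsP.
by exists ((vbasis U)`_i, (vbasis V)`_j); rewrite !mem_nth ?size_tuple.
Qed.

Lemma lievP U V W :
  reflect (forall u v, u \in U -> v \in V -> lie u v \in W) (liev U V <= W)%VS.
Proof.
apply: (iffP idP) => [/subvP sUV u v Uu Vv | sUV].
  exact/sUV/memv_lie.
apply/span_subvP => _ /allpairsP[[u v] /= [Uu Vv ->]].
by apply: sUV; apply: vbasis_mem.
Qed.

End LieSubalgebras.

Arguments lie_derived {F} L.

Section ComaximalGraph.
Variables (F : finFieldType) (L : lieAlgType F).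
Implicit Types (A B U : {vspace L}).

(* The subalgebra generated by A and B, as the least one containing both.     *)
Definition lie_gen A B : {vspace L} :=
  (\bigcap_(U : {vspace L} | [&& lie_subalg U, A <= U & B <= U]) U)%VS.

Lemma lie_gen_subalg A B : lie_subalg (lie_gen A B).
Proof.
apply/lievP => u v /subv_bigcapP Gu /subv_bigcapP Gv.
apply/subv_bigcapP => U PU; have /and3P[/lievP subU _ _] := PU.
by apply: subU; [apply: Gu | apply: Gv].
Qed.

Lemma lie_genP A B U :
  lie_subalg U -> (lie_gen A B <= U)%VS = (A <= U)%VS && (B <= U)%VS.
Proof.
move=> subU; apply/idP/andP=> [sGU | [sAU sBU]].
  by split; apply: subv_trans sGU; apply/subv_bigcapP => W /and3P[].
by apply: (bigcapv_inf U) => //; rewrite subU sAU.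
Qed.

Definition lie_subalgs_of_dim (d : nat) : {set {vspace L}} :=
  [set A : {vspace L} | lie_subalg A & \dim A == d].

Definition comax_vertices : {set {vspace L}} :=
  [set A : {vspace L} | [&& lie_subalg A, A != 0%VS & A != fullv]].

Definition comax_adj : rel {vspace L} := fun A B =>
  [&& A \in comax_vertices, B \in comax_vertices, A != B
    & lie_gen A B == fullv].

Definition comax_deg A : nat :=
  #|[set B in comax_vertices | comax_adj A B]|.

Lemma comax_adj_irr : irreflexive comax_adj.
Proof. by move=> A; rewrite /comax_adj eqxx !andbF. Qed.

Lemma comax_adj_sym : symmetric comax_adj.
Proof.
move=> A B; rewrite /comax_adj andbCA eq_sym; congr [&& _, _, _ & _ == _].
by apply: eq_bigl => U; rewrite [(A <= U)%VS && _]andbC.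
Qed.

End ComaximalGraph.

Arguments lie_subalgs_of_dim {F} L d.
Arguments comax_vertices {F} L.

(* The subgraph of e induced on S is isomorphic to K_n.                       *)
Definition induces_complete (T : finType) (e : rel T) (S : {set T}) (n : nat) :
    Prop :=
  exists f : 'I_n -> T,
    [/\ injective f, [set f i | i : 'I_n] = S
      & forall i j, e (f i) (f j) = (i != j)].

(* Main.v *)
(* Two distinct vertices are adjacent exactly when no two-dimensional           *)
(* subalgebra contains both, since the subalgebra they generate is proper iff   *)
(* it is a plane. Everything thus reduces to the incidence table between the    *)
(* lines <x + a y + b z>, <y + c z>, <z> and the planes <x + a y, z>,           *)
(* <y, x + c z>, <y, z>, which is read off in coordinates; the degrees are sums *)
(* of rows of this table.                                                       *)

Require Import Defs.
From HB Require Import structures.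
From mathcomp Require Import all_boot all_order all_algebra all_field.
From mathcomp Require Import ring zify.

Set Implicit Arguments.
Unset Strict Implicit.
Unset Printing Implicit Defensive.

Import GRing.Theory.
Local Open Scope ring_scope.

(** In coordinates the bracket is [y] times the determinant of the [x]- and [y]-coordinates
    ([lie_xyz]). A plane through [y] therefore absorbs all brackets and is a subalgebra. A plane
    subalgebra [A] avoiding [y] differs from [V] and meets it in a line; bracketing a generator of
    that line with an element of [A] outside [V] gives a multiple of [y] in [A], which must vanish,
    so the line is [<z>]. Hence the two families of planes ([plane_ex_of_y], [plane_ex_of_notin_y]).

    Each plane is the kernel of one linear form ([mem_plane]) and each line has a normalised
    generator ([line_ex]), so incidence is the finite table [mem_gen]. Since every vertex lies in a
    plane, [comax_adj_planes] turns adjacency into a question about this table, and [comax_degE]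
    turns degrees into sums over the codes of lines and planes. *)

(** * Generalities on brackets, spans and counting *)

Lemma lieC (K : fieldType) (L : lieAlgType K) (u v : L) : lie u v = - lie v u.
Proof.
have /eqP := lieuu (u + v).
by rewrite linearDl /= !linearDr /= !lieuu add0r addr0 addr_eq0 => /eqP.
Qed.

Lemma span2P (K : fieldType) (vT : vectType K) (u v w : vT) :
  reflect (exists a b, w = a *: u + b *: v) (w \in <<[:: u; v]>>%VS).
Proof.
rewrite span_cons span_seq1; apply: (iffP memv_addP).
  by move=> [_ /vlineP[a ->] [_ /vlineP[b ->] ->]]; exists a, b.
by move=> [a [b ->]]; exists (a *: u); last exists (b *: v);
  rewrite ?memvZ ?memv_line.
Qed.

Lemma dim_span2 (K : fieldType) (vT : vectType K) (u v : vT) :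
  v != 0 -> u \notin <[v]>%VS -> \dim <<[:: u; v]>> = 2%N.
Proof.
move=> v0 uv; apply/eqP; have -> : 2%N = size [:: u; v] by [].
by rewrite -[_ == _]/(free _) free_cons span_seq1 uv seq1_free v0.
Qed.

(** Turns a count of neighbours into a sum of 0/1 values over codes, which can then be split along
    the shape of the code type. *)
Lemma card_imset_set (T T' : finType) (f : T -> T') (e : pred T') :
  injective f -> #|[set B in [set f t | t : T] | e B]| = (\sum_t e (f t))%N.
Proof.
move=> f_inj; rewrite -sum1_card.
under eq_bigl do rewrite inE.
by rewrite big_mkcondr big_imset /=; last exact: in2W.
Qed.

Lemma sum_neq (T : finType) (c : T) : (\sum_t (t != c) = #|T|.-1)%N.
Proof.
rewrite -(cardC1 c) -sum1_card [RHS]big_mkcond.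
by apply: eq_bigr => t _; rewrite inE /=; case: eqP.
Qed.

Lemma sum_neqC (T : finType) (c : T) : (\sum_t (c != t) = #|T|.-1)%N.
Proof. by under eq_bigr do rewrite eq_sym; apply: sum_neq. Qed.

Lemma sum_const_fin (T : finType) (n : nat) : (\sum_(t : T) n = #|T| * n)%N.
Proof. by rewrite sum_nat_const. Qed.

Lemma sum_option (T : finType) (f : option T -> nat) :
  (\sum_o f o = f None + \sum_t f (Some t))%N.
Proof.
rewrite (bigD1 None) //= (reindex_omap Some id) /=; last by case.
by congr (_ + _)%N; apply: eq_bigl => t; rewrite eqxx.
Qed.

(** * Coordinates, bracket, derived algebra and centre *)

Section SplitExtension.

Variables (F : finFieldType) (L : lieAlgType F) (x y z : L).
Hypothesis basis_xyz : basis_of fullv [:: x; y; z].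
Hypotheses (lie_xy : lie x y = y) (lie_xz : lie x z = 0) (lie_yz : lie y z = 0).
Implicit Types (A B U : {vspace L}) (u v w : L).

Local Notation e := [tuple x; y; z].
Local Notation cx := (coord e 0).
Local Notation cy := (coord e 1).
Local Notation cz := (coord e 2%:R).

Lemma decomp_xyz u : u = cx u *: x + cy u *: y + cz u *: z.
Proof.
rewrite {1}(coord_basis (X := e) basis_xyz (memvf u)).
rewrite !big_ord_recl big_ord0 /= addr0 addrA.
by congr (_ + _ *: _ + _ *: _); congr (coord _ _ _); apply: val_inj.
Qed.

Let free_xyz : free e. Proof. exact: basis_free basis_xyz. Qed.

Lemma coord_xyz : ((cx x = 1) * (cy x = 0) * (cz x = 0)) *
  ((cx y = 0) * (cy y = 1) * (cz y = 0)) * ((cx z = 0) * (cy z = 0) * (cz z = 1)).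
Proof.
have c i j := coord_free i j free_xyz.
by do !split; first [exact: (c 0) | exact: (c 1) | exact: (c 2%:R)].
Qed.

Lemma coordD i u v : coord e i (u + v) = coord e i u + coord e i v.
Proof. exact: linearD. Qed.

Lemma coordZ i a u : coord e i (a *: u) = a * coord e i u.
Proof. exact: linearZ. Qed.

Definition coordE := (coordD, coordZ, coord_xyz).

(** Reduces vector identities to scalar ones within reach of [ring] and [field]. *)
Lemma coord_inj u v : cx u = cx v -> cy u = cy v -> cz u = cz v -> u = v.
Proof. by move=> ux uy uz; rewrite [u]decomp_xyz ux uy uz -decomp_xyz. Qed.

(** Expanding bilinearly, only the brackets of [x] with [y] survive, with opposite signs. *)
Lemma lie_xyz u v : lie u v = (cx u * cy v - cx v * cy u) *: y.
Proof.
rewrite {1}[u]decomp_xyz {1}[v]decomp_xyz.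
rewrite !linearDl /= !linearZl_LR /= !linearDr /= !linearZr_LR /= !lieuu.
rewrite (lieC y x) (lieC z x) (lieC z y) lie_xy lie_xz lie_yz.
rewrite !oppr0 !scaler0 !addr0 !add0r.
by rewrite !scalerN !scalerA scalerBl scaler0 addr0 [cx v * _]mulrC.
Qed.

Let dimL : \dim (fullv : {vspace L}) = 3%N.
Proof. by have := size_basis (X := e) basis_xyz. Qed.

Lemma derived_xyz : lie_derived L = <[y]>%VS.
Proof.
apply/eqP; rewrite eqEsubv; apply/andP; split.
  by apply/lievP => u v _ _; rewrite lie_xyz memvZ ?memv_line.
by rewrite -memvE -lie_xy memv_lie ?memvf.
Qed.

Lemma central_xyz u : lie_central u <-> u \in <[z]>%VS.
Proof.
split=> [uZ|/vlineP[c ->] v]; last first.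
  by rewrite lie_xyz !coordE !mulr0 mul0r subr0 scale0r.
apply/vlineP; exists (cz u).
(* Bracketing [u] with [y] isolates [cx u], and with [x] isolates [- cy u]. *)
have /(congr1 cy) := uZ x; have /(congr1 cy) := uZ y.
rewrite !lie_xyz !coordE linear0 !(mul0r, mulr0, mulr1, mul1r, subr0, sub0r) => ux /eqP.
rewrite oppr_eq0 => /eqP uy.
by rewrite {1}[u]decomp_xyz ux uy !scale0r !add0r.
Qed.

(** * Coded planes and lines, and their incidence *)

(* [inl a] encodes the plane [P_a]; the codes [inr _] are the planes through    *)
(* [y], with [inr None] standing for [V].                                       *)
Definition plane (p : F + option F) : {vspace L} :=
  match p with
  | inl a => <<[:: (x + a *: y)%R; z]>>%VS
  | inr (Some c) => <<[:: y; (x + c *: z)%R]>>%VS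
  | inr None => <<[:: y; z]>>%VS
  end.

(** Each plane is the kernel of a linear form; the coefficients on the two spanning vectors can be
    read off as coordinates. *)
Lemma mem_plane p u : (u \in plane p) =
  match p with
  | inl a => cy u == a * cx u
  | inr (Some c) => cz u == c * cx u
  | inr None => cx u == 0
  end.
Proof.
case: p => [a|[c|]] /=; apply/span2P/eqP.
- by move=> [r [s ->]]; rewrite !coordE; ring.
- move=> uE; exists (cx u), (cz u).
  by apply: coord_inj; rewrite !coordE ?uE; ring.
- by move=> [r [s ->]]; rewrite !coordE; ring.
- move=> uE; exists (cy u), (cx u).
  by apply: coord_inj; rewrite !coordE ?uE; ring.
- by move=> [r [s ->]]; rewrite !coordE; ring.
- move=> uE; exists (cy u), (cz u).
  by apply: coord_inj; rewrite !coordE ?uE; ring.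
Qed.

Lemma dim_plane p : \dim (plane p) = 2%N.
Proof.
have nz u (f : 'I_3) : coord e f u != 0 -> u != 0.
  by apply: contraNneq => ->; rewrite linear0.
case: p => [a|[c|]] /=; apply: dim_span2.
- by apply: (nz _ 2%:R); rewrite coord_xyz oner_eq0.
- apply/negP => /vlineP[r /(congr1 cx)/eqP].
  by rewrite !coordE !mulr0 addr0 oner_eq0.
- by apply: (nz _ 0); rewrite !coordE mulr0 addr0 oner_eq0.
- apply/negP => /vlineP[r yE]; have := congr1 cy yE; have := congr1 cx yE.
  by rewrite !coordE !(mulr0, addr0, mulr1) => _ /eqP; rewrite oner_eq0.
- by apply: (nz _ 2%:R); rewrite coord_xyz oner_eq0.
- by apply/negP => /vlineP[r /(congr1 cy)/eqP]; rewrite !coordE mulr0 oner_eq0.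
Qed.

(** Planes through [y] contain every bracket. In [P_a] the [x]- and [y]-coordinates are
    proportional, so the determinant vanishes. *)
Lemma plane_subalg p : lie_subalg (plane p).
Proof.
apply/lievP => u v; rewrite !mem_plane lie_xyz !coordE.
case: p => [a|[c|]] => [/eqP -> /eqP ->|_ _|_ _]; apply/eqP; ring.
Qed.

Lemma plane_abelian a : lie_abelian (plane (inl a)).
Proof.
rewrite /lie_abelian -subv0; apply/lievP => u v.
rewrite !mem_plane lie_xyz memv0 => /eqP -> /eqP ->.
by rewrite [X in X *: y](_ : _ = 0) ?scale0r //; ring.
Qed.

(** Normal form up to scaling: the first nonzero coordinate, in the order [x], [y], [z], is 1. The
    codes [inr _] are the lines of [V], with [<y>] coded by [inr (Some 0)]. *)
Definition gen (l : F * F + option F) : L :=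
  match l with
  | inl ab => x + ab.1 *: y + ab.2 *: z
  | inr (Some c) => y + c *: z
  | inr None => z
  end.

Definition line l : {vspace L} := <[gen l]>%VS.

Lemma mem_gen l p : (gen l \in plane p) =
  match l, p with
  | inl ab, inl a => ab.1 == a
  | inl ab, inr (Some c) => ab.2 == c
  | inl _, inr None => false
  | inr (Some _), inl _ => false
  | inr (Some c), inr (Some _) => c == 0
  | inr None, inr (Some _) => false
  | inr _, inr None | inr None, inl _ => true
  end.
Proof.
rewrite mem_plane.
case: l p => [[a b]|[c|]] [d|[d|]] /=;
  by rewrite !coordE !(mulr0, mulr1, addr0, add0r, oner_eq0, eqxx).
Qed.

Lemma line_planeE l p : (line l <= plane p)%VS = (gen l \in plane p).
Proof. by rewrite memvE. Qed.

(** Every generator misses some plane, whereas 0 lies in all of them. *)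
Lemma gen_neq0 l : gen l != 0.
Proof.
have [p] : exists p, gen l \notin plane p.
  case: l => [ab|[c|]]; [exists (inr None)|exists (inl 0)|exists (inr (Some 0))];
  by rewrite mem_gen.
by apply: contraNneq => ->; rewrite mem0v.
Qed.

Lemma dim_line l : \dim (line l) = 1%N.
Proof. by rewrite dim_vline gen_neq0. Qed.

Lemma line_subalg l : lie_subalg (line l).
Proof.
apply/lievP => _ _ /vlineP[a ->] /vlineP[b ->].
by rewrite linearZl_LR /= linearZr_LR /= lieuu !scaler0 mem0v.
Qed.

(** Proportional generators have the same leading position, and the leading 1 forces the scalar to
    be 1. *)
Lemma line_inj : injective line.
Proof.
move=> l m lm; have /vlineP[k] : gen l \in line m by rewrite -lm memv_line.
move=> lE; have := congr1 cx lE; have := congr1 cy lE; have := congr1 cz lE.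
case: l m {lm lE} => [[a b]|[c|]] [[a' b']|[c'|]] //=;
  rewrite !coordE !(mulr0, mulr1, addr0, add0r) => Ez Ey Ex;
  move: Ez Ey; rewrite -?Ex ?mul0r ?mul1r.
- by move=> -> ->.
- by move: Ex => /eqP; rewrite oner_eq0.
- by move: Ex => /eqP; rewrite oner_eq0.
- by move=> _ /eqP; rewrite oner_eq0.
- by move=> + k1; rewrite -k1 mul1r => ->.
- by move=> _ /eqP; rewrite oner_eq0.
- by move=> /eqP; rewrite oner_eq0.
- by move=> + k0; rewrite -k0 mul0r => /eqP; rewrite oner_eq0.
Qed.

(** Any two differently coded planes are told apart by a test line: [<z>] or [<y>] across families,
    [X_{a,0}] or [X_{0,c}] within one. *)
Lemma plane_inj : injective plane.
Proof.
move=> p r pr.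
have {pr} E l : (gen l \in plane p) = (gen l \in plane r) by rewrite pr.
case: p r E => [a|[c|]] [a'|[c'|]] E //.
- by have := E (inl (a, 0)); rewrite !mem_gen /= eqxx => /esym/eqP ->.
- by have := E (inr None); rewrite !mem_gen.
- by have := E (inr (Some 0)); rewrite !mem_gen.
- by have := E (inr None); rewrite !mem_gen.
- by have := E (inl (0, c)); rewrite !mem_gen /= eqxx => /esym/eqP ->.
- by have := E (inr None); rewrite !mem_gen.
- by have := E (inr (Some 0)); rewrite !mem_gen.
- by have := E (inr None); rewrite !mem_gen.
Qed.

(** * Classification of the lines and planes *)

Lemma line_ex u : u != 0 -> exists l, <[u]>%VS = line l.
Proof.
have vlineE v k : k != 0 -> u = k *: v -> <[u]>%VS = <[v]>%VS.
  move=> k0 ->; apply/eqP; rewrite eqEdim -memvE memvZ ?memv_line //=.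
  by rewrite !dim_vline scaler_eq0 negb_or k0.
move=> u0; have [ux0|ux0] := eqVneq (cx u) 0; last first.
  exists (inl (cy u / cx u, cz u / cx u)); apply: (vlineE _ _ ux0).
  by apply: coord_inj; rewrite /= !coordE; field.
have [uy0|uy0] := eqVneq (cy u) 0; last first.
  exists (inr (Some (cz u / cy u))); apply: (vlineE _ _ uy0).
  by apply: coord_inj; rewrite /= !coordE ?ux0; field.
exists (inr None); apply: (vlineE _ (cz u)).
  apply: contraNneq u0 => uz0; apply/eqP.
  by apply: coord_inj; rewrite linear0.
by apply: coord_inj; rewrite /= !coordE ?ux0 ?uy0; ring.
Qed.

Arguments gen : simpl never.

Lemma lines_xyz : lie_subalgs_of_dim L 1 = [set line l | l : F * F + option F].
Proof.
apply/setP => A; rewrite inE; apply/andP/imsetP => [[_ dA]|[l _ ->]]; last first.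
  by rewrite line_subalg dim_line.
have A0 : vpick A != 0 by rewrite vpick0 -dimv_eq0 (eqP dA).
have [l Al] := line_ex A0; exists l => //; rewrite -Al.
by apply/eqP; rewrite eq_sym eqEdim -memvE memv_pick dim_vline A0 (eqP dA).
Qed.

Lemma plane_sub_eq A p : \dim A = 2%N -> (plane p <= A)%VS -> A = plane p.
Proof. by move=> dA pA; apply/eqP; rewrite eq_sym eqEdim pA dA dim_plane. Qed.

(** Removing the [y]-part of some [u] in [A] outside [<y>] leaves a nonzero combination of [x] and
    [z]; its slope is the code, with [None] when the [x]-coordinate is 0. *)
Lemma plane_ex_of_y A : \dim A = 2%N -> y \in A -> exists o, A = plane (inr o).
Proof.
move=> dA yA; have /subvPn[u uA uy] : ~~ (A <= <[y]>)%VS.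
  by apply: contraL (leqnn 2) => /dimvS; rewrite dA dim_vline; case: (y != 0).
have uyA : u - cy u *: y \in A by rewrite rpredB ?memvZ.
have [ux0|ux0] := eqVneq (cx u) 0.
  have uz0 : cz u != 0.
    apply: contraNneq uy => uz0; rewrite [u]decomp_xyz ux0 uz0.
    by rewrite !scale0r add0r addr0; apply/memvZ/memv_line.
  exists None; apply: plane_sub_eq dA _; apply/span_subvP => w.
  rewrite !inE => /orP[] /eqP -> //.
  suff -> : z = (cz u)^-1 *: (u - cy u *: y) by rewrite memvZ.
  by rewrite -scaleN1r; apply: coord_inj; rewrite !coordE ?ux0; field.
exists (Some (cz u / cx u)); apply: plane_sub_eq dA _; apply/span_subvP => w.
rewrite !inE => /orP[] /eqP -> //.
suff -> : x + (cz u / cx u) *: z = (cx u)^-1 *: (u - cy u *: y) by rewrite memvZ.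
by rewrite -scaleN1r; apply: coord_inj; rewrite !coordE; field.
Qed.

(* If [u] and [r y + c z] lie in [A] with [cx u != 0], their bracket is          *)
(* [cx u * r] times [y], whence [r = 0] and [z] lies in [A].                     *)
Lemma plane_ex_of_notin_y A :
  lie_subalg A -> \dim A = 2%N -> y \notin A -> exists a, A = plane (inl a).
Proof.
move=> /lievP subA dA yA.
have /subvPn[u uA] : ~~ (A <= plane (inr None))%VS.
  apply: contra yA => AV; suff -> : A = plane (inr None).
    by rewrite mem_plane coord_xyz.
  by apply/eqP; rewrite eqEdim AV dA dim_plane.
rewrite mem_plane => ux0.
have /subvPn[w wA wu] : ~~ (A <= <[u]>)%VS.
  by apply: contraL (leqnn 2) => /dimvS; rewrite dA dim_vline; case: (u != 0).
(* The multiple of [u] is chosen to cancel the [x]-coordinate, so [w'] spans the intersection of [A]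
   with [V]. *)
have [w' w'E] : exists w', w' = w - (cx w / cx u) *: u by eexists.
have w'A : w' \in A by rewrite w'E rpredB ?memvZ.
have w'x : cx w' = 0 by rewrite w'E -scaleN1r !coordE; field.
have w'y : cy w' = 0.
  apply: contraNeq yA => w'y; have := subA _ _ uA w'A.
  by rewrite lie_xyz w'x mul0r subr0 rpredZeq mulf_eq0 (negPf ux0) (negPf w'y).
have zA : z \in A.
  have w'z : cz w' != 0.
    apply: contraNneq wu => w'z; have w'0 : w' = 0.
      by apply: coord_inj; rewrite linear0.
    by move/eqP: w'0; rewrite w'E subr_eq0 => /eqP ->; apply/memvZ/memv_line.
  suff -> : z = (cz w')^-1 *: w' by rewrite memvZ.
  by apply: coord_inj; rewrite !coordE ?w'x ?w'y; field.
exists (cy u / cx u); apply: plane_sub_eq dA _; apply/span_subvP => v.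
rewrite !inE => /orP[] /eqP -> //.
suff -> : x + (cy u / cx u) *: y = (cx u)^-1 *: (u - cz u *: z).
  by rewrite memvZ // rpredB // memvZ.
by rewrite -scaleN1r; apply: coord_inj; rewrite !coordE; field.
Qed.

Lemma planes_xyz : lie_subalgs_of_dim L 2 = [set plane p | p : F + option F].
Proof.
apply/setP => A; rewrite inE; apply/andP/imsetP => [[sA /eqP dA]|[p _ ->]].
  have [yA|yA] := boolP (y \in A).
    by have [o ->] := plane_ex_of_y dA yA; exists (inr o).
  by have [a ->] := plane_ex_of_notin_y sA dA yA; exists (inl a).
by rewrite plane_subalg dim_plane.
Qed.

Lemma planes_y_xyz :
  [set P : {vspace L} | \dim P == 2%N & (lie_derived L <= P)%VS] =
  [set plane (inr o) | o : option F].
Proof.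
apply/setP => A; rewrite inE derived_xyz -memvE.
apply/andP/imsetP => [[/eqP dA yA]|[o _ ->]].
  by have [o ->] := plane_ex_of_y dA yA; exists o.
by rewrite dim_plane mem_plane; case: o => [c|]; rewrite !coord_xyz ?mulr0.
Qed.

(** * Vertices and adjacency *)

(** In dimension 3, the nonzero proper subspaces are those of dimension 1 or 2. *)
Lemma comax_vertices_xyz :
  comax_vertices L = lie_subalgs_of_dim L 1 :|: lie_subalgs_of_dim L 2.
Proof.
apply/setP => A; rewrite !inE -andb_orr -dimv_eq0.
have := dimvS (subvf A); rewrite dimL => dimA.
have -> : (A == fullv) = (\dim A == 3) by rewrite eqEdim subvf dimL eqn_leq dimA.
by case: (\dim A) dimA => [|[|[|[|n]]]]; rewrite ?andbF.
Qed.

Lemma line_vertex l : line l \in comax_vertices L.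
Proof. by rewrite comax_vertices_xyz !inE line_subalg dim_line. Qed.

Lemma plane_vertex p : plane p \in comax_vertices L.
Proof. by rewrite comax_vertices_xyz !inE plane_subalg dim_plane orbT. Qed.

Lemma vertexP A : reflect ((exists l, A = line l) \/ (exists p, A = plane p))
  (A \in comax_vertices L).
Proof.
apply: (iffP idP) => [|[[l ->]|[p ->]]]; rewrite ?line_vertex ?plane_vertex //.
rewrite comax_vertices_xyz lines_xyz planes_xyz inE.
by case/orP => /imsetP[t _ ->]; [left|right]; exists t.
Qed.

Lemma line_in_plane l : exists p, gen l \in plane p.
Proof.
case: l => [ab|[c|]].
- by exists (inl ab.1); rewrite mem_gen.
- by exists (inr None); rewrite mem_gen.
- by exists (inr None); rewrite mem_gen.
Qed.

(* The case [A = B] needs no exception, as every vertex lies in a plane. *)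
Lemma comax_adj_planes A B : A \in comax_vertices L -> B \in comax_vertices L ->
  comax_adj A B = [forall p, ~~ ((A <= plane p)%VS && (B <= plane p)%VS)].
Proof.
have in_plane C : C \in comax_vertices L -> exists p, (C <= plane p)%VS.
  case/vertexP => [[l ->]|[p ->]]; last by exists p.
  by have [p] := line_in_plane l; exists p; rewrite line_planeE.
move=> vA vB; rewrite /comax_adj vA vB /=.
apply/andP/forallP => [[_ /eqP genAB] p|noP].
  apply: contraL (leqnn 3) => /(introT idP).
  rewrite -lie_genP ?plane_subalg // genAB => /dimvS.
  by rewrite dimL dim_plane.
split.
  apply/eqP => eqAB; have [p Ap] := in_plane _ vA.
  by have := noP p; rewrite -eqAB Ap.
apply: contraT => genN.
(* If proper, the generated subalgebra is itself a vertex, being nonzero because it contains [A]; a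
   plane containing it contains both [A] and [B]. *)
have [|p] := in_plane (lie_gen A B).
  rewrite inE lie_gen_subalg genN andbT /= -subv0.
  move: vA; rewrite inE => /and3P[_ + _]; apply: contra => gen0.
  rewrite -subv0; apply: subv_trans gen0.
  by have := lie_genP A B (lie_gen_subalg A B); rewrite subvv => /esym/andP[].
by rewrite lie_genP ?plane_subalg // (negPf (noP p)).
Qed.

Lemma comax_adj_line_line l m : comax_adj (line l) (line m) =
  match l, m with
  | inl ab, inl cd => (ab.1 != cd.1) && (ab.2 != cd.2)
  | inl _, inr (Some c) | inr (Some c), inl _ => c != 0
  | _, _ => false
  end.
Proof.
rewrite comax_adj_planes ?line_vertex //.
under eq_forallb do rewrite !line_planeE.
(* Non-adjacency is settled by exhibiting a common plane; adjacency needs a check of all three kinds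
   of planes. *)
have mem p : gen l \in plane p -> gen m \in plane p ->
    [forall p, ~~ ((gen l \in plane p) && (gen m \in plane p))] = false.
  by move=> lp mp; apply/negP => /forallP/(_ p); rewrite lp mp.
case: l m mem => [[a b]|[c|]] [[a' b']|[c'|]] mem /=.
- have [eqa|neqa] := eqVneq a a'.
    by apply: (mem (inl a)); rewrite mem_gen /= ?eqa.
  have [eqb|neqb] := eqVneq b b'.
    by apply: (mem (inr (Some b))); rewrite mem_gen /= ?eqb.
  apply/forallP => -[d|[d|]]; rewrite !mem_gen //=.
    by apply/negP => /andP[/eqP <- /eqP a'a]; rewrite a'a eqxx in neqa.
  by apply/negP => /andP[/eqP <- /eqP b'b]; rewrite b'b eqxx in neqb.
- have [c0|c0] := eqVneq c' 0.
    by apply: (mem (inr (Some b))); rewrite mem_gen /= ?c0.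
  by apply/forallP => -[d|[d|]]; rewrite !mem_gen //= ?(negPf c0) andbF.
- by apply: (mem (inl a)); rewrite mem_gen /=.
- have [c0|c0] := eqVneq c 0.
    by apply: (mem (inr (Some b'))); rewrite mem_gen /= ?c0.
  by apply/forallP => -[d|[d|]]; rewrite !mem_gen //= ?(negPf c0).
- by apply: (mem (inr None)); rewrite mem_gen.
- by apply: (mem (inr None)); rewrite mem_gen.
- by apply: (mem (inl a')); rewrite mem_gen /=.
- by apply: (mem (inr None)); rewrite mem_gen.
- by apply: (mem (inr None)); rewrite mem_gen.
Qed.

Lemma subv_plane p r : (plane p <= plane r)%VS = (p == r).
Proof.
by rewrite -(inj_eq plane_inj) eqEdim !dim_plane andbT.
Qed.

(** The only plane containing [plane p] is itself. *)
Lemma comax_adj_line_plane l p :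
  comax_adj (line l) (plane p) = (gen l \notin plane p).
Proof.
rewrite comax_adj_planes ?line_vertex ?plane_vertex //.
apply/forallP/idP => [/(_ p)|lp r]; first by rewrite subvv andbT line_planeE.
by rewrite subv_plane line_planeE andbC; case: eqP => // <-.
Qed.

Lemma comax_adj_plane_plane p r : comax_adj (plane p) (plane r) = (p != r).
Proof.
rewrite comax_adj_planes ?plane_vertex //; apply/forallP/idP => [/(_ r)|pr s].
  by rewrite subv_plane subvv andbT.
by rewrite !subv_plane; apply: contra pr => /andP[/eqP -> /eqP ->].
Qed.

Lemma disjoint_lines_planes :
  [disjoint lie_subalgs_of_dim L 1 & lie_subalgs_of_dim L 2].
Proof.
rewrite disjoint_subset; apply/subsetP => A.
by rewrite !inE => /andP[_ /eqP ->]; rewrite andbF.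
Qed.

(** * Degrees *)

Lemma comax_degE A : comax_deg A =
  (\sum_l comax_adj A (line l) + \sum_p comax_adj A (plane p))%N.
Proof.
rewrite -(card_imset_set _ line_inj) -(card_imset_set _ plane_inj).
rewrite -lines_xyz -planes_xyz -cardsUI.
rewrite [_ :&: _](_ : _ = set0) ?cards0 ?addn0.
  by apply: eq_card => B; rewrite comax_vertices_xyz !inE andb_orl.
apply/setP => B; rewrite !inE.
by case: (\dim B =P 1%N) => [->|]; rewrite ?andbF ?andFb.
Qed.

(** With [q = #|F|], a line outside [V] has [(q-1)^2 + (q-1)] line neighbours and [2(q-1) + 1] plane
    neighbours. In [V], a line other than [<y>] and [<z>] has [q^2] and [2q], while [<y>] sees only
    the [P_a] and [<z>] only the planes through [y] other than [V]. *)
Lemma comax_deg_line l : comax_deg (line l) =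
  match l with
  | inl _ => (#|F| ^ 2 + #|F| - 1)%N
  | inr (Some c) => if c == 0 then #|F| else (#|F| ^ 2 + 2 * #|F|)%N
  | inr None => #|F|
  end.
Proof.
have F_gt0 : (0 < #|F|)%N by apply/card_gt0P; exists 0.
rewrite comax_degE.
under eq_bigr do rewrite comax_adj_line_line.
under [X in (_ + X)%N]eq_bigr do rewrite comax_adj_line_plane mem_gen.
rewrite !big_sumType /= !sum_option.
case: l => [[a b]|[c|]] /=.
- rewrite -(pair_bigA _ (fun c d => (a != c) && (b != d) : nat)) /=.
  (* Written as a product, the conjunction lets the double sum factor as [(q-1) * (q-1)]. *)
  under eq_bigr do under eq_bigr do rewrite -mulnb.
  under eq_bigr do rewrite -big_distrr.
  rewrite -big_distrl /=.
  rewrite !(sum_neq, sum_neqC).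
  (* Writing [q = n + 1] removes the truncated predecessors. *)
  case: #|F| F_gt0 => // n _; rewrite -mulnn; nia.
- rewrite !sum_const_fin card_prod.
  by have [_|_] := eqVneq c 0; rewrite /= -?mulnn; lia.
- by rewrite !sum_const_fin !(muln0, muln1).
Qed.

(** A plane contains [q + 1] of the [q^2 + q + 1] lines, so it is adjacent to the other [q^2], and
    to the other [2q] planes. *)
Lemma comax_deg_plane p : comax_deg (plane p) = (#|F| ^ 2 + 2 * #|F|)%N.
Proof.
have F_gt0 : (0 < #|F|)%N by apply/card_gt0P; exists 0.
rewrite comax_degE.
under eq_bigr do rewrite comax_adj_sym comax_adj_line_plane mem_gen.
under [X in (_ + X)%N]eq_bigr do rewrite comax_adj_plane_plane eq_sym.
rewrite sum_neq card_sum card_option.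
rewrite !big_sumType /= !sum_option.
rewrite -(pair_bigA _ (fun a b => ~~ match p with
  | inl c => a == c | inr (Some c) => b == c | inr None => false end : nat)) /=.
case: p => [c|[c|]] /=.
- under eq_bigr do rewrite sum_const_fin.
  rewrite -big_distrr /= sum_neq !sum_const_fin.
  case: #|F| F_gt0 => // n _; rewrite -mulnn; nia.
- rewrite !sum_neq !sum_const_fin.
  case: #|F| F_gt0 => // n _; rewrite -mulnn; nia.
- rewrite !sum_const_fin !muln0.
  case: #|F| F_gt0 => // n _; rewrite -mulnn; nia.
Qed.

(** * From codes back to subspaces, and the theorem *)

Lemma line_y : line (inr (Some 0)) = <[y]>%VS.
Proof. by rewrite /line /gen scale0r addr0. Qed.

Lemma line_z : line (inr None) = <[z]>%VS.
Proof. by []. Qed.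

Lemma line_in_V A : A \in lie_subalgs_of_dim L 1 -> (A <= <<[:: y; z]>>)%VS ->
  A != <[y]>%VS -> A != <[z]>%VS -> exists2 c, c != 0 & A = line (inr (Some c)).
Proof.
rewrite lines_xyz => /imsetP[[ab|[c|]] _ ->].
- by rewrite (line_planeE _ (inr None)) mem_gen.
- by move=> _ c0 _; exists c => //; apply: contraNneq c0 => ->; rewrite line_y.
- by rewrite line_z eqxx.
Qed.

Lemma line_notin_V A : A \in lie_subalgs_of_dim L 1 ->
  ~~ (A <= <<[:: y; z]>>)%VS -> exists ab, A = line (inl ab).
Proof.
rewrite lines_xyz => /imsetP[[ab|o] _ ->]; first by exists ab.
by rewrite (line_planeE _ (inr None)) mem_gen; case: o.
Qed.

End SplitExtension.

(** The enumeration of [S], reindexed by ['I_n], is the required isomorphism. *)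
Lemma induces_complete_of_card (T : finType) (e : rel T) (S : {set T}) n :
  #|S| = n -> {in S &, forall t u, e t u = (t != u)} -> induces_complete e S n.
Proof.
move=> cardS eS; pose f i := enum_val (cast_ord (esym cardS) i).
have f_inj : injective f by move=> i j /enum_val_inj/cast_ord_inj.
have fS i : f i \in S by apply: enum_valP.
exists f; split=> // [|i j]; last by rewrite eS // (inj_eq f_inj).
apply/eqP; rewrite eqEcard card_imset // card_ord cardS leqnn andbT.
by apply/subsetP => _ /imsetP[i _ ->].
Qed.

Theorem proposition4p5 (F : finFieldType) (q : nat) (card_F : #|F| = q)
    (L : lieAlgType F) (x y z : L)
    (basis_xyz : basis_of fullv [:: x; y; z])
    (lie_xy : lie x y = y) (lie_xz : lie x z = 0) (lie_yz : lie y z = 0) :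
  let lines := lie_subalgs_of_dim L 1 in
  let planes := lie_subalgs_of_dim L 2 in
  let V : {vspace L} := <<[:: y; z]>>%VS in
  let Pl (a : F) : {vspace L} := <<[:: (x + a *: y)%R; z]>>%VS in
  let X (a b : F) : {vspace L} := <[(x + a *: y + b *: z)%R]>%VS in
  let planes_y := [set P : {vspace L} | \dim P == 2%N & (lie_derived L <= P)%VS] in
  (* L' and Z(L) *)
  [/\ lie_derived L = <[y]>%VS
    & forall u : L, lie_central u <-> u \in <[z]>%VS] /\
  (* the planes *)
  [/\ planes = planes_y :|: [set Pl a | a : F],
      #|planes_y| = q.+1,
      #|[set Pl a | a : F]| = q,
      forall a : F, [/\ \dim (Pl a) = 2%N, lie_abelian (Pl a) & y \notin Pl a]
    & #|planes| = (2 * q + 1)%N] /\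
  (* the vertex set *)
  [/\ comax_vertices L = lines :|: planes & [disjoint lines & planes]] /\
  (* (1) *)
  [/\ {in planes &, forall A B, A != B -> comax_adj A B}
    & induces_complete (@comax_adj F L) planes (2 * q + 1)%N] /\
  (* (2) *)
  {in lines & planes, forall A P, comax_adj A P = ~~ (A <= P)%VS} /\
  (* (3)(a) *)
  [/\ <[y]>%VS \in lines, <[z]>%VS \in lines
    & {in lines, forall B, ~~ comax_adj <[y]>%VS B /\ ~~ comax_adj <[z]>%VS B}]
    /\
  (* (3)(b) *)
  {in lines, forall A, (A <= V)%VS -> A != <[y]>%VS -> A != <[z]>%VS ->
    {in lines, forall B, comax_adj A B = ~~ (B <= V)%VS}} /\
  (* (3)(c) *)
  [/\ forall a b : F, X a b \in lines /\ ~~ (X a b <= V)%VS,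
      {in lines, forall A, ~~ (A <= V)%VS ->
        exists! ab : F * F, A = X ab.1 ab.2}
    & forall a b c d : F, comax_adj (X a b) (X c d) = (a != c) && (b != d)] /\
  (* (4) *)
  [/\ {in planes, forall P, comax_deg P = (q ^ 2 + 2 * q)%N},
      comax_deg <[y]>%VS = q,
      comax_deg <[z]>%VS = q,
      {in lines, forall A, (A <= V)%VS -> A != <[y]>%VS -> A != <[z]>%VS ->
        comax_deg A = (q ^ 2 + 2 * q)%N}
    & {in lines, forall A, ~~ (A <= V)%VS -> comax_deg A = (q ^ 2 + q - 1)%N}].
Proof.
move=> lines planes V Pl X planes_y.
(* The subspaces of the statement are the coded ones by computation, so the results on codes apply
   to them directly. *)
have XE a b : X a b = line x y z (inl (a, b)) by [].
have VE : V = plane x y z (inr None) by [].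
have linesE : lines = _ := lines_xyz basis_xyz.
have planesE : planes = _ := planes_xyz basis_xyz lie_xy lie_xz lie_yz.
have planes_yE : planes_y = _ := planes_y_xyz basis_xyz lie_xy lie_xz lie_yz.
have yE := line_y x y z; have zE := line_z x y z.
have pinj := plane_inj basis_xyz; have linj := line_inj basis_xyz.
have card_planes : #|planes| = (2 * q + 1)%N.
  by rewrite planesE card_imset // card_sum card_option card_F; lia.
have adj_planes : {in planes &, forall A B, comax_adj A B = (A != B)}.
  move=> A B; rewrite planesE => /imsetP[p _ ->] /imsetP[r _ ->].
  by rewrite comax_adj_plane_plane // (inj_eq pinj).
split.
  by split; [exact: (derived_xyz basis_xyz) | move=> u; exact: (central_xyz basis_xyz)].
split.
  split=> //.
  - apply/setP => A; rewrite planesE planes_yE inE.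
    apply/imsetP/orP => [[[a|o] _ ->]|[/imsetP[o _ ->]|/imsetP[a _ ->]]].
    + by right; apply: imset_f.
    + by left; apply: (imset_f (fun o => plane x y z (inr o))).
    + by exists (inr o).
    + by exists (inl a).
  - rewrite planes_yE card_imset ?card_option ?card_F //.
    by move=> o o' /pinj[].
  - rewrite card_imset //.
    by move=> a a' /(pinj (inl a) (inl a'))[].
  - move=> a; split; [exact: (dim_plane basis_xyz (inl a)) | exact: plane_abelian |].
    by rewrite (mem_plane basis_xyz (inl a)) !(coord_xyz basis_xyz) mulr0 oner_eq0.
split.
  by split; [exact: (comax_vertices_xyz basis_xyz) | exact: disjoint_lines_planes].
split.
  split; first by move=> A B SA SB; rewrite adj_planes.
  exact: induces_complete_of_card.
split.
  move=> A P; rewrite linesE planesE => /imsetP[l _ ->] /imsetP[p _ ->].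
  by rewrite comax_adj_line_plane.
split.
  split; rewrite ?linesE -?yE -?zE ?imset_f // => B /imsetP[l _ ->].
  by rewrite !comax_adj_line_line //; case: l => [|[]] //=; rewrite eqxx.
split.
  move=> A lA AV Ay Az B; have [c c0 ->] := line_in_V basis_xyz lA AV Ay Az.
  rewrite linesE VE => /imsetP[l _ ->].
  by rewrite comax_adj_line_line // line_planeE mem_gen //; case: l => [|[]].
split.
  split.
  - move=> a b; rewrite linesE XE VE imset_f // line_planeE.
    by rewrite (mem_gen basis_xyz).
  - move=> A lA AV; have [[a b] ->] := line_notin_V basis_xyz lA AV.
    exists (a, b); split=> // -[c d] /(linj (inl (a, b)) (inl (c, d))).
    by move=> [-> ->].
  - by move=> a b c d; rewrite !XE comax_adj_line_line.
rewrite -card_F; split.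
- by move=> P; rewrite planesE => /imsetP[p _ ->]; apply: comax_deg_plane.
- by rewrite -yE comax_deg_line // eqxx.
- by rewrite -zE comax_deg_line.
- move=> A lA AV Ay Az; have [c c0 ->] := line_in_V basis_xyz lA AV Ay Az.
  by rewrite comax_deg_line // (negPf c0).
- move=> A lA AV; have [ab ->] := line_notin_V basis_xyz lA AV.
  by rewrite comax_deg_line.
Qed.
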